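(* Let $(\Omega,\mathcal F,\mu)$ be a measure space with $\mu(\Omega)=\infty$, $p\in[1,\infty)$ and $k\ge1$. Then $\mathscr G_{p,k}$ is proximinal in $L^p(\Omega,\mathcal F,\mu)$. Moreover, let $f\in L^p$ and let $g=\sum_{i=1}^q b_i\mathbf 1_{A_i}$ be a minimizer with $q\le k$, $b_1<\dots<b_q$ real, $\{A_i\}_{1\le i\le q}$ a measurable partition of $\Omega$ with $\mu(A_i)>0$ for all $i$, and let $s$ be the unique index with $b_s=0$. Put $r_1=-\infty$, $r_{q+1}=+\infty$, $r_i=\frac{b_{i-1}+b_i}{2}$ for $2\le i\le q$ (so $r_s<0<r_{s+1}$), and $C_i=f^{-1}([r_i,r_{i+1}))$. Then $\mu(C_i)<\infty$ for $i\ne s$, for each $i\ne s$ with $\mu(C_i)>0$ the number $b_i$ is a $p$-th mean of $f$ on $C_i$, and $\tilde g=\sum_{i\ne s}\mathcal M_p(f,C_i)\mathbf 1_{C_i}+0\cdot\mathbf 1_{C_s}$ is a minimizer in $\mathscr G_{p,q}$. If $q$ is the smallest number of distinct values among all minimizers, then $\mu(C_i)>0$ for all $i$.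
   Context: $\mathscr G_{p,k}$ is the set of functions $\sum_{i=1}^l a_i\mathbf 1_{A_i}\in L^p$ with $l\le k$, $\{A_i\}$ a measurable partition of $\Omega$, $a_i\in\mathbb R$ (membership in $L^p$ forces $a_i=0$ when $\mu(A_i)=\infty$); $\mathscr D_{p,k}(f)=\inf\{\|f-h\|_p:\ h\in\mathscr G_{p,k}\}$; a minimizer is any $g\in\mathscr G_{p,k}$ with $\|f-g\|_p=\mathscr D_{p,k}(f)$. $p$-th mean: for measurable $A$ with $0<\mu(A)<\infty$, a $p$-th mean of $f$ on $A$ is any minimizer over $a\in\mathbb R$ of $\int_A|f-a|^p\,d\mu$; for $p>1$ it is unique and denoted $\mathcal M_p(f,A)$; for $p=1$ the minimizers form a bounded closed interval $[a^*,b^*]$ and $\mathcal M_1(f,A)=(a^*+b^* )/2$; if $\mu(A)=0$, $\mathcal M_p(f,A)=0$. *)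

(* Defs.v *)
From HB Require Import structures.
From mathcomp Require Import all_boot all_order all_algebra.
From mathcomp Require Import all_classical all_reals all_analysis.
Set Implicit Arguments. Unset Strict Implicit. Unset Printing Implicit Defensive.
Import Order.TTheory GRing.Theory Num.Theory.
Import numFieldNormedType.Exports.
Local Open Scope classical_set_scope.
Local Open Scope ring_scope.

Section Defs.
Context {d : measure_display} {T : measurableType d} {R : realType}.
Variable mu : {measure set T -> \bar R}.

Definition inLp (p : R) (f : T -> R) : Prop :=
  measurable_fun setT f /\ finite_norm mu p%:E f.

Definition Lpdist (p : R) (f h : T -> R) : \bar R :=
  Lnorm mu p%:E (EFin \o (f \- h)).

Definition mpartition (l : nat) (A : nat -> set T) : Prop :=
  (forall i, (i < l)%N -> measurable (A i)) /\
  (forall i j, (i < l)%N -> (j < l)%N -> i <> j -> A i `&` A j = set0) /\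
  (forall x, exists2 i, (i < l)%N & A i x).

Definition stepfun (l : nat) (a : nat -> R) (A : nat -> set T) : T -> R :=
  fun x => \sum_(i < l) a i * \1_(A i) x.

Definition Gpk (p : R) (k : nat) : set (T -> R) :=
  [set h | exists l : nat, exists a : nat -> R, exists A : nat -> set T,
     [/\ (l <= k)%N, mpartition l A, h = stepfun l a A & inLp p h]].

Definition Dpk (p : R) (k : nat) (f : T -> R) : \bar R :=
  ereal_inf [set Lpdist p f h | h in Gpk p k].

Definition minimizer (p : R) (k : nat) (f g : T -> R) : Prop :=
  Gpk p k g /\ Lpdist p f g = Dpk p k f.

Definition proximinal (p : R) (k : nat) : Prop :=
  forall f, inLp p f -> exists g, minimizer p k f g.

Definition pth_mean (p : R) (f : T -> R) (A : set T) (a : R) : Prop :=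
  forall b : R,
    (\int[mu]_(x in A) (`|f x - a| `^ p)%:E <=
     \int[mu]_(x in A) (`|f x - b| `^ p)%:E)%E.

(* M_p(f,A): 0 if mu A = 0; the unique p-th mean if p > 1;
   midpoint of the interval of p-th means if p = 1 *)
Definition Mp (p : R) (f : T -> R) (A : set T) : R :=
  if mu A == 0%E then 0
  else if 1 < p then xget 0 [set a | pth_mean p f A a]
  else (inf [set a | pth_mean p f A a] + sup [set a | pth_mean p f A a]) / 2.

Definition at_most_values (h : T -> R) (m : nat) : Prop :=
  exists s : seq R, (size s <= m)%N /\ forall x, h x \in s.

End Defs.

(* thresholds r_0 = -oo, r_q = +oo, r_i = (b_{i-1} + b_i)/2 for 0 < i < q
   (0-based version of the paper's r_1, ..., r_{q+1}) *)
Definition rcut {R : realType} (q : nat) (b : nat -> R) (i : nat) : \bar R :=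
  if i == 0%N then -oo%E
  else if (q <= i)%N then +oo%E
  else ((b i.-1 + b i) / 2)%:E.

Definition Cset {T} {R : realType} (q : nat) (b : nat -> R) (f : T -> R) (i : nat)
  : set T :=
  [set x | (rcut q b i <= (f x)%:E)%E /\ ((f x)%:E < rcut q b i.+1)%E].

(* Main.v *)
Require Import Defs.
From HB Require Import structures.
From mathcomp Require Import all_boot all_order all_algebra.
From mathcomp Require Import all_classical all_reals all_analysis.
From mathcomp Require Import measurable_realfun ring lra.
Import Order.TTheory GRing.Theory Num.Theory.
Import numFieldNormedType.Exports.
Local Open Scope classical_set_scope.
Local Open Scope ring_scope.

(** As [mu] is infinite, every function of [Gpk] takes the value 0. Replacing a
    step function by the one that takes, at each point, the value nearest to [f]
    does not increase the error at any point; this turns a minimizer into one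
    that is constant on each [C i], whose values can then be optimized piece by
    piece.

    Existence: along a subsequence of a minimizing sequence [h n], each value
    either converges or tends to infinity in absolute value. Let [g x] be the
    point nearest to [f x] among 0 and the finite limits. A diverging value is
    eventually a worse approximation of [f x] than 0, so |f x - g x| is at most
    the lower limit of |f x - h n x|, and [g] is a minimizer. *)

(** * The [p]-th power of the [L^p] distance *)

Section Lpow.
Context {d : measure_display} {T : measurableType d} {R : realType}.
Context (mu : {measure set T -> \bar R}) (p : R) (p1 : 1 <= p).

(** Unlike the norm, this power of the error is additive over disjoint pieces [D]. *)
Definition Lpow (D : set T) (f h : T -> R) : \bar R :=
  \int[mu]_(x in D) (`|f x - h x| `^ p)%:E.

Let p0 : 0 < p. Proof. exact: lt_le_trans ltr01 p1. Qed.

Lemma Lpow_ge0 D f h : (0 <= Lpow D f h)%E.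
Proof. by apply: integral_ge0 => x _; rewrite lee_fin powR_ge0. Qed.

Lemma LpdistE f h : Lpdist mu p f h = (Lpow setT f h `^ p^-1)%E.
Proof. by rewrite /Lpdist unlock. Qed.

(** On [[0, +oo]] the [p]-th root is increasing with increasing inverse, so infinite errors are
    covered too. *)
Lemma le_Lpdist f g h :
  (Lpdist mu p f g <= Lpdist mu p f h)%E = (Lpow setT f g <= Lpow setT f h)%E.
Proof.
have K h' : ((Lpow setT f h' `^ p^-1) `^ p = Lpow setT f h')%E.
  by rewrite -poweRrM mulVf ?gt_eqF// poweRe1// Lpow_ge0.
rewrite !LpdistE; apply/idP/idP => gh; last first.
  by apply: gt0_ler_poweR => //; rewrite ?invr_ge0 ?ltW ?in_itv//= ?Lpow_ge0 leey.
rewrite -K -[leRHS]K; apply: gt0_ler_poweR => //.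
- exact: ltW.
- by rewrite in_itv/= poweR_ge0 leey.
- by rewrite in_itv/= poweR_ge0 leey.
Qed.

Lemma minimizerP k f g : minimizer mu p k f g <->
  Gpk mu p k g /\ forall h, Gpk mu p k h -> (Lpow setT f g <= Lpow setT f h)%E.
Proof.
split=> -[Gg gmin]; split=> //.
  move=> h Gh; rewrite -le_Lpdist gmin; apply: ereal_inf_lbound.
  by exists h.
apply/eqP; rewrite eq_le; apply/andP; split.
  by apply: le_ereal_inf_tmp => _ [h Gh <-]; rewrite le_Lpdist; exact: gmin.
by apply: ereal_inf_lbound; exists g.
Qed.

Lemma inLpE f : inLp mu p f <-> f \in Lfun mu p%:E.
Proof.
split=> [[mf nf]|]; first by rewrite inE; apply/andP; split; rewrite inE.
by rewrite inE => /andP[/[!inE]].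
Qed.

Lemma inLpP f : inLp mu p f <->
  measurable_fun setT f /\ (\int[mu]_x (`|f x| `^ p)%:E < +oo)%E.
Proof.
rewrite /inLp /finite_norm unlock /=; split=> -[mf nf]; split=> //.
  by apply: lty_poweRy nf; rewrite invr_eq0 gt_eqF.
exact: poweR_lty.
Qed.

Lemma measurable_Lpow D (f h : T -> R) :
  measurable_fun setT f -> measurable_fun setT h ->
  measurable_fun D (fun x => (`|f x - h x| `^ p)%:E).
Proof.
move=> mf mh; apply: measurable_funTS; apply/measurable_EFinP.
apply: (measurableT_comp (measurable_powR _)).
by apply: measurableT_comp => //; exact: measurable_funB.
Qed.

Lemma le_Lpow D (f g h : T -> R) : measurable D -> measurable_fun setT f ->
  measurable_fun setT g -> measurable_fun setT h ->
  (forall x, D x -> `|f x - g x| <= `|f x - h x|) ->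
  (Lpow D f g <= Lpow D f h)%E.
Proof.
move=> mD mf mg mh gh; apply: ge0_le_integral => //.
- exact: measurable_Lpow.
- exact: measurable_Lpow.
- move=> x Dx; rewrite lee_fin ge0_ler_powR ?nnegrE ?(ltW p0)//; exact: gh.
Qed.

(** Minkowski, in the form that [Lfun] is closed under sums and opposites. *)
Lemma Lpow_fin f h : inLp mu p f -> inLp mu p h -> (Lpow setT f h < +oo)%E.
Proof.
move=> /inLpE Lf /inLpE Lh.
have p1E : (1 <= p%:E)%E by rewrite lee_fin.
have [_ addL] := @Lfun_addr_closed _ _ _ mu _ p1E.
have oppL := @Lfun_oppr_closed _ _ _ mu p%:E.
by have /inLpE/inLpP[_] := addL _ _ Lf (oppL _ Lh).
Qed.

(** Since [h = f - (f - h)], a finite error is enough to admit a new competitor to [L^p]. *)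
Lemma inLp_Lpow f h : inLp mu p f -> measurable_fun setT h ->
  (Lpow setT f h < +oo)%E -> inLp mu p h.
Proof.
move=> Lf mh fh; apply/inLpE.
have p1E : (1 <= p%:E)%E by rewrite lee_fin.
have [_ addL] := @Lfun_addr_closed _ _ _ mu _ p1E.
have oppL := @Lfun_oppr_closed _ _ _ mu p%:E.
have -> : h = f + (- (f - h)) by rewrite opprB addrC subrK.
apply: addL; first exact/inLpE.
apply: oppL; apply/inLpE/inLpP; split=> //.
by apply: measurable_funB => //; case: Lf.
Qed.

(** Markov's inequality: [e ^ p] times the measure of [C] is at most the integral of [|f| ^ p]. *)
Lemma Lp_superlevel_fin f C e : inLp mu p f -> measurable C -> 0 < e ->
  (forall x, C x -> e <= `|f x|) -> (mu C < +oo)%E.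
Proof.
move=> /inLpP[mf Lf] mC e0 Ce.
have : (\int[mu]_(x in C) (cst (e `^ p)%:E) x <= \int[mu]_x (`|f x| `^ p)%:E)%E.
  have mfp : measurable_fun setT (fun x => (`|f x| `^ p)%:E).
    apply/measurable_EFinP; apply: (measurableT_comp (measurable_powR _)).
    exact: measurableT_comp.
  apply: (@le_trans _ _ (\int[mu]_(x in C) (`|f x| `^ p)%:E)%E).
    apply: ge0_le_integral => //.
    - by move=> x _; rewrite lee_fin powR_ge0.
    - exact: measurable_funTS.
    - move=> x Cx; rewrite lee_fin ge0_ler_powR ?nnegrE ?(ltW p0) ?(ltW e0)//.
      exact: Ce.
  by apply: ge0_subset_integral => // x _; rewrite lee_fin powR_ge0.
rewrite integral_cst// => /le_lt_trans/(_ Lf).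
by apply: contraTlt; rewrite leye_eq => /eqP ->; rewrite gt0_muley// lte_fin powR_gt0.
Qed.

End Lpow.

(** * Step functions on partitions, and measurable choice of a nearest value *)

Section Partition.
Context {d : measure_display} {T : measurableType d} {R : realType}.

Lemma stepfunE (l : nat) (a : nat -> R) (A : nat -> set T) i x :
  mpartition l A -> (i < l)%N -> A i x -> stepfun l a A x = a i.
Proof.
move=> [_ [disjA _]] il Aix; rewrite /stepfun (bigD1 (Ordinal il))//=.
rewrite indicE mem_set// mulr1 big1 ?addr0// => j ji.
rewrite indicE memNset ?mulr0// => Ajx.
have /disjA : (j : nat) <> i by move=> /eqP; apply/negP; exact: ji.
move=> /(_ (ltn_ord j) il)/seteqP[+ _] => /(_ x); exact.
Qed.

Lemma measurable_stepfun (l : nat) (a : nat -> R) (A : nat -> set T) :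
  mpartition l A -> measurable_fun setT (stepfun l a A).
Proof.
move=> [mA _]; apply: measurable_sum => i; apply: measurable_funM => //.
by apply: measurable_indic; exact: mA.
Qed.

Lemma integral_mpartition (mu : {measure set T -> \bar R}) (l : nat)
    (A : nat -> set T) (F : T -> \bar R) :
  mpartition l A -> measurable_fun setT F -> (forall x, 0 <= F x)%E ->
  (\int[mu]_x F x = \sum_(i < l) \int[mu]_(x in A i) F x)%E.
Proof.
move=> [mA [disjA covA]] mF F0.
have DE : \big[setU/set0]_(i < l) A i = setT.
  apply/seteqP; split=> // x _; have [i il Aix] := covA x.
  by rewrite (bigD1 (Ordinal il))//=; left.
rewrite -ge0_integral_bigsetU//.
- by rewrite DE.
- by move=> i; exact: mA.
- exact: index_enum_uniq.
- move=> i j _ _ [x [Aix Ajx]]; apply/val_inj; apply: contrapT => ij.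
  have /seteqP[+ _] := disjA i j (ltn_ord i) (ltn_ord j) ij.
  by move=> /(_ x); exact.
- exact: measurable_funTS.
Qed.

Lemma ler_dist_below_mid (a b y : R) :
  a <= b -> y <= (a + b) / 2 -> `|y - a| <= `|y - b|.
Proof.
move=> ab yab; rewrite [leRHS]ler0_norm; last lra.
by rewrite ler_norml; apply/andP; split; lra.
Qed.

Lemma ler_dist_above_mid (a b y : R) :
  a <= b -> (a + b) / 2 <= y -> `|y - b| <= `|y - a|.
Proof.
move=> ab yab; rewrite [leRHS]ger0_norm; last lra.
by rewrite ler_norml; apply/andP; split; lra.
Qed.

Section Cset.
Context (q : nat) (b : nat -> R).
Context (b_incr : forall i j, (i < j)%N -> (j < q)%N -> b i < b j).

Lemma values_le i j : (i <= j)%N -> (j < q)%N -> b i <= b j.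
Proof. by rewrite leq_eqVlt => /orP[/eqP -> //|ij jq]; exact/ltW/b_incr. Qed.

Lemma rcutS i : (i.+1 < q)%N -> rcut q b i.+1 = ((b i + b i.+1) / 2)%:E.
Proof. by rewrite /rcut/= ltnNge => /negbTE ->. Qed.

(** The left side is the upper end of cell [i], the right side the lower end of a later cell; this
    yields disjointness. *)
Lemma rcut_le i j : (i < j)%N -> (rcut q b i.+1 <= rcut q b j)%E.
Proof.
case: j => // j; rewrite ltnS => ij; have [jq|qj] := ltnP j.+1 q; last first.
  by rewrite [leRHS]/rcut/= qj leey.
rewrite !rcutS//; last exact: leq_ltn_trans jq.
rewrite lee_fin ler_pM2r ?invr_gt0//.
by apply: lerD; apply: values_le => //; exact: ltnW.
Qed.

Lemma measurable_Cset (f : T -> R) i :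
  measurable_fun setT f -> measurable (Cset q b f i).
Proof.
(* An interval of extended reals treats the infinite thresholds like the others. *)
move=> mf; have -> : Cset q b f i =
    setT `&` (EFin \o f) @^-1` [set` `[rcut q b i, rcut q b i.+1[%E].
  apply/seteqP; split=> x; rewrite /Cset/= in_itv/=; first by move=> [-> ->].
  by move=> [_ /andP[]].
have /measurable_EFinP mEf := mf.
by apply: mEf => //; exact: emeasurable_itv.
Qed.

Lemma Cset_mpartition (f : T -> R) : (0 < q)%N ->
  measurable_fun setT f -> mpartition q (Cset q b f).
Proof.
move=> q0 mf; split; first by move=> i _; exact: measurable_Cset.
split=> [|x].
  have disj i j : (i < j)%N -> Cset q b f i `&` Cset q b f j = set0.
    move=> ij; apply/seteqP; split=> // x [[_ xi] [xj _]].
    by have := lt_le_trans xi (le_trans (rcut_le _ _ ij) xj); rewrite ltxx.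
  move=> i j _ _ /eqP; rewrite neq_ltn => /orP[|] ij; first exact: disj.
  by rewrite setIC; exact: disj.
(* The cell of [x] is the first one whose upper threshold exceeds [f x]; cell [q.-1] is a candidate,
   its upper threshold being [+oo]. *)
have ex : exists i, ((f x)%:E < rcut q b i.+1)%E.
  by exists q.-1; rewrite prednK// /rcut leqnn gtn_eqF// ltry.
case: (ex_minnP ex) => i xi imin; exists i.
  rewrite -[q]prednK// ltnS; apply: imin.
  by rewrite prednK// /rcut leqnn gtn_eqF// ltry.
split=> //; case: i xi imin => [|i] xi imin; first by rewrite /rcut leNye.
by rewrite leNgt; apply/negP => /imin; rewrite ltnn.
Qed.

(** For [j > i], [f x] lies below the midpoint of [b i] and [b i.+1], hence below that of [b i] and
    [b j]; the case [j < i] is symmetric. *)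
Lemma Cset_nearest (f : T -> R) i j x : (i < q)%N -> (j < q)%N ->
  Cset q b f i x -> `|f x - b i| <= `|f x - b j|.
Proof.
move=> iq jq [ix xi]; have [ij|ji|-> //] := ltngtP i j.
- have i1q : (i.+1 < q)%N := leq_ltn_trans ij jq.
  move: xi; rewrite rcutS// lte_fin => xi.
  apply: ler_dist_below_mid; first by apply: values_le => //; exact: ltnW.
  by have := values_le _ _ ij jq; lra.
- case: i iq ix ji {xi} => // i iq ix ji.
  move: ix; rewrite rcutS// lee_fin => ix.
  apply: ler_dist_above_mid; first by apply: values_le => //; exact: ltnW.
  by have := values_le j i ji (ltnW iq); lra.
Qed.

End Cset.

(** Sorting [s] without repetitions gives strictly increasing values, whose midpoint cells realize
    the nearest choice. *)
Lemma nearest_stepfun (f : T -> R) (s : seq R) :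
  measurable_fun setT f -> (0 < size s)%N ->
  exists l b A, [/\ (l <= size s)%N, @mpartition _ T l A,
    forall x, stepfun l b A x \in s &
    forall x y, y \in s -> `|f x - stepfun l b A x| <= `|f x - y| :> R].
Proof.
move=> mf s0; pose t := sort <=%R (undup s).
have mem_t y : (y \in t) = (y \in s) by rewrite mem_sort mem_undup.
have t0 : (0 < size t)%N.
  have [y ys] : exists y, y \in s by case: (s) s0 => // y ? _; exists y; exact: mem_head.
  by move: ys; rewrite -mem_t; case: (t).
have t_incr i j : (i < j)%N -> (j < size t)%N -> t`_i < t`_j.
  move=> ij jt.
  have st : sorted <%R t by rewrite sort_lt_sorted undup_uniq.
  by rewrite (lt_sorted_ltn_nth 0 st)// inE// (ltn_trans ij).
exists (size t), (nth 0 t), (Cset (size t) (nth 0 t) f).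
have mC := Cset_mpartition _ _ t_incr f t0 mf.
have [_ [_ covC]] := mC.
split=> //.
- by rewrite size_sort size_undup.
- move=> x; have [i it Ci] := covC x.
  by rewrite (stepfunE _ _ _ _ _ mC it Ci) -mem_t mem_nth.
- move=> x y; rewrite -mem_t => /(nthP 0)[j jt <-].
  have [i it Ci] := covC x; rewrite (stepfunE _ _ _ _ _ mC it Ci).
  exact: (Cset_nearest _ _ t_incr).
Qed.

End Partition.

(** * Subsequences along which finitely many real sequences converge or diverge *)

Section Subsequences.
Context {R : realType}.

(** In the divergent case [b] is a placeholder, so that one function can list the limits of all
    sequences. *)
Definition cvg_or_dvg (u : nat -> R) (b : R) : Prop :=
  u @ \oo --> b \/ `|u n| @[n --> \oo] --> +oo.

Lemma increasing_seq_cvg (phi : nat -> nat) : increasing_seq phi -> phi @ \oo --> \oo.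
Proof.
move=> iphi A [N _ NA]; exists N => // n /= Nn; apply: NA => /=.
apply: leq_trans Nn _; elim: n => // n /leq_ltn_trans; apply.
by move/increasing_seqP : iphi; exact.
Qed.

Lemma cvg_or_dvg_subseq u b (phi : nat -> nat) : increasing_seq phi ->
  cvg_or_dvg u b -> cvg_or_dvg (u \o phi) b.
Proof.
move=> /increasing_seq_cvg phioo [ub|uoo]; [left|right].
  exact: (cvg_comp _ _ phioo ub).
exact: (cvg_comp phi (fun n => `|u n|) phioo uoo).
Qed.

(** A cluster point gives a convergent subsequence. Without one, the whole sequence eventually
    leaves every segment [[-M, M]], by compactness. *)
Lemma subseq_cvg_or_dvg (u : nat -> R) :
  exists2 phi, increasing_seq phi & exists b, cvg_or_dvg (u \o phi) b.
Proof.
have [[a /cluster_eventually_cvg[phi iphi ua]]|nocl] :=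
    pselect (exists a, cluster (u @ \oo) a).
  by exists phi => //; exists a; left.
exists id; first by [].
exists 0; right; apply/cvgryPgt => M.
have /compact_near_coveringP cov := @segment_compact R (- M) M.
(* Each point has a neighbourhood that [u] avoids from some rank on; the near-covering property
   makes this rank uniform over the segment. *)
have /cov : forall x, `[- M, M]%classic x ->
    \forall x' \near x & n \near \oo, x' <> u n.
  move=> x _.
  have /cluster_eventuallyP : ~ cluster (u @ \oo) x by move=> ?; apply: nocl; exists x.
  move=> /existsNP[e /existsNP[N /not_implyP[e0 nxu]]].
  exists (ball x e, [set n | (N <= n)%N]) => /=.
    by split; [exact: nbhsx_ballx|exists N].
  move=> [x' n] /= [xx' Nn] x'u; apply: nxu; exists n => //.
  by rewrite -x'u; exact/ltW.
apply: filterS => n /= Mu; rewrite ltNge; apply/negP => uM.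
by apply: (Mu (u n)) => //=; rewrite in_itv/= -ler_norml.
Qed.

(** Extract once per sequence; each earlier alternative survives further extraction. *)
Lemma multi_subseq_cvg_or_dvg (m : nat) (c : nat -> nat -> R) :
  exists2 phi, increasing_seq phi & exists b : nat -> R,
    forall i, (i < m)%N -> cvg_or_dvg (fun n => c (phi n) i) (b i).
Proof.
elim: m => [|m [phi iphi [b cb]]]; first by exists id => //; exists (fun=> 0).
have [psi ipsi [bm cbm]] := subseq_cvg_or_dvg (fun n => c (phi n) m).
exists (phi \o psi); first by move=> i j /=; rewrite iphi; exact: ipsi.
exists (fun i => if i == m then bm else b i) => i; rewrite ltnS leq_eqVlt.
have [-> _|_ /= im] := eqVneq i m; first exact: cbm.
exact: cvg_or_dvg_subseq ipsi (cb _ im).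
Qed.

End Subsequences.

Lemma continuous_powR_pos (R : realType) (p a : R) :
  0 < a -> {for a, continuous (@powR R ^~ p)}.
Proof.
move=> a0; apply: differentiable_continuous; apply/derivable1_diffP.
by apply: derivable_powR; rewrite in_itv/= a0.
Qed.

(** * Existence of a best approximation *)

Section Proximinal.
Context {d : measure_display} {T : measurableType d} {R : realType}.
Context (mu : {measure set T -> \bar R}) (p : R) (p1 : 1 <= p).

Let p0 : 0 < p. Proof. exact: lt_le_trans ltr01 p1. Qed.

(** Finitely many finite measures cannot add up to [+oo]. *)
Lemma mpartition_infinite (l : nat) (A : nat -> set T) :
  mu setT = +oo%E -> mpartition l A -> exists2 i, (i < l)%N & mu (A i) = +oo%E.
Proof.
move=> muT mA; apply: contrapT => fin.
have : mu setT = (\sum_(i < l) mu (A i))%E.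
  rewrite -[LHS]mul1e -integral_cst// (integral_mpartition _ _ _ _ mA)//.
  apply: eq_bigr => i _; rewrite integral_cst ?mul1e//.
  by case: mA => mA _; exact: mA.
rewrite muT => sumE.
have : (\sum_(i < l) mu (A i) < +oo)%E.
  apply: lte_sum_pinfty => i _; rewrite ltey; apply/eqP => Ai.
  by apply: fin; exists i.
by rewrite -sumE ltxx.
Qed.

Lemma stepfun_value0 (l : nat) a (A : nat -> set T) i :
  mpartition l A -> inLp mu p (stepfun l a A) -> (i < l)%N ->
  mu (A i) = +oo%E -> a i = 0.
Proof.
move=> mA La il Aioo; apply/eqP/negPn/negP => ai0.
have : (mu (A i) < +oo)%E.
  apply: (Lp_superlevel_fin mu p p1 _ _ `|a i| La).
  - by case: mA => mA _; exact: mA.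
  - by rewrite normr_gt0.
  - by move=> x Ax; rewrite (stepfunE _ _ _ _ _ mA il Ax).
by rewrite Aioo ltxx.
Qed.

(** The value on a piece of infinite measure is 0, so its index can be removed. The strict bound on
    the size leaves room for 0 next to the limit values. *)
Lemma Gpk_values k h : mu setT = +oo%E -> Gpk mu p k h ->
  exists2 s : seq R, (size s < k)%N & forall x, h x \in 0 :: s.
Proof.
move=> muT [l [a [A [lk mA -> Lh]]]].
have [i0 i0l Ai0] := mpartition_infinite _ _ muT mA.
have a0 := stepfun_value0 _ _ _ _ mA Lh i0l Ai0.
exists [seq a i | i <- rem i0 (iota 0 l)].
  rewrite size_map size_rem ?mem_iota// size_iota prednK//.
  exact: leq_ltn_trans i0l.
move=> x; have [_ [_ covA]] := mA; have [i il Ai] := covA x.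
rewrite (stepfunE _ _ _ _ _ mA il Ai) inE.
have [->|ii0] := eqVneq i i0; first by rewrite a0 eqxx.
apply/orP; right; apply: map_f.
by rewrite mem_rem_uniq ?iota_uniq// !inE ii0 mem_iota.
Qed.

Lemma Gpk_stepfun k (l : nat) a (A : nat -> set T) : (l <= k)%N ->
  mpartition l A -> inLp mu p (stepfun l a A) -> Gpk mu p k (stepfun l a A).
Proof. by move=> lk mA LA; exists l, a, A. Qed.

Lemma Gpk_measurable k h : Gpk mu p k h -> measurable_fun setT h.
Proof. by move=> [? [? [? [_ _ _ []]]]]. Qed.

(** As 0 is among the values, the error is at most [|f|], which puts the nearest step function in
    [L^p]. *)
Lemma nearest_Gpk f (s : seq R) k : inLp mu p f -> 0 \in s -> (size s <= k)%N ->
  exists2 g, Gpk mu p k g &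
    forall x y, y \in s -> `|f x - g x| <= `|f x - y| :> R.
Proof.
move=> Lf s0 sk.
have ss : (0 < size s)%N by case: s s0 {sk}.
have [mf _] := Lf.
have [l [b [A [ls mA bs near_s]]]] := nearest_stepfun f s mf ss.
have mb := measurable_stepfun l b A mA.
exists (stepfun l b A) => //; apply: Gpk_stepfun => //; first exact: leq_trans sk.
apply: (inLp_Lpow mu p p1 f) => //.
apply: (@le_lt_trans _ _ (Lpow mu p setT f (cst 0))).
  apply: le_Lpow => //.
  by move=> x _; exact: near_s.
have /inLpP[//|_] := Lf.
by apply: le_lt_trans; rewrite /Lpow; under eq_integral do rewrite /cst subr0.
Qed.

(** A bound of Fatou type: the last hypothesis says that [|f - g|] is pointwise at most the lower
    limit of [|f - h n|]. *)
Lemma Lpow_liminf f g (h : nat -> T -> R) v : inLp mu p f -> inLp mu p g ->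
  (forall n, measurable_fun setT (h n)) ->
  (fun n => Lpow mu p setT f (h n)) @ \oo --> v ->
  (forall x e, 0 < e -> \forall n \near \oo, `|f x - g x| - e <= `|f x - h n x|) ->
  (Lpow mu p setT f g <= v)%E.
Proof.
move=> Lf Lg mh hv fgh.
have [mf _] := Lf; have [mg _] := Lg.
(* Truncating |f - h n| at |f - g| makes dominated convergence applicable. *)
pose w n x := Num.min `|f x - g x| `|f x - h n x|.
have mw n : measurable_fun setT (w n).
  apply: measurable_minr; apply: measurableT_comp => //; exact: measurable_funB.
have mwp n : measurable_fun setT (fun x => (w n x `^ p)%:E).
  by apply/measurable_EFinP; apply: (measurableT_comp (measurable_powR _)).
have mgp := measurable_Lpow p setT _ _ mf mg.
have w0 n x : 0 <= w n x by rewrite le_min !normr_ge0.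
have wL n x : w n x <= `|f x - g x| by rewrite ge_min lexx.
have w_cvg x : w n x @[n --> \oo] --> `|f x - g x|.
  apply/cvgrPdist_le => e e0; have := fgh x e e0; apply: filterS => n fghn.
  rewrite ger0_norm ?subr_ge0// lerBlDl -lerBlDr le_min fghn andbT.
  by rewrite gerBl ltW.
have wp_cvg x : (w n x `^ p)%:E @[n --> \oo] --> (`|f x - g x| `^ p)%:E.
  apply: cvg_EFin; first exact: nearW.
  (* Continuity of the power is available at positive points; at a zero limit every [w n x] is
     already 0. *)
  have [L0|L0] := eqVneq `|f x - g x| 0.
    have -> : fine \o (fun n => (w n x `^ p)%:E) = cst (`|f x - g x| `^ p).
      apply/funext => n /=; congr (_ `^ _); apply/le_anti.
      by rewrite wL L0 w0.
    exact: cvg_cst.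
  apply: (@cvg_comp _ _ _ (fun n => w n x) (@powR R ^~ p)); first exact: w_cvg.
  by apply: continuous_powR_pos; rewrite lt_def L0 normr_ge0.
have ig : mu.-integrable setT (fun x => (`|f x - g x| `^ p)%:E).
  apply/integrableP; split=> //.
  under eq_integral do rewrite /= ger0_norm ?powR_ge0//.
  exact: (Lpow_fin mu p p1 f g).
have [] := @dominated_convergence _ _ _ mu setT measurableT
  (fun n x => (w n x `^ p)%:E) (fun x => (`|f x - g x| `^ p)%:E)
  (fun x => (`|f x - g x| `^ p)%:E) mwp mgp _ ig _.
- by apply: aeW => x _; exact: wp_cvg.
- apply: aeW => x n _; rewrite /= ger0_norm ?powR_ge0// lee_fin.
  by rewrite ge0_ler_powR ?nnegrE ?(ltW p0).
(* The integrals of [w n ^ p] tend to the error of [g], and each is at most the error of [h n]. *)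
move=> _ _ cvg_w; apply: lee_cvg_to cvg_w hv _; apply: nearW => n.
apply: ge0_le_integral => //.
- by move=> x _; rewrite lee_fin powR_ge0.
- exact: measurable_Lpow.
- move=> x _; rewrite lee_fin ge0_ler_powR ?nnegrE ?(ltW p0)//.
  by rewrite ge_min lexx orbT.
Qed.

Lemma proximinal_Gpk k : mu setT = +oo%E -> (0 < k)%N -> proximinal mu p k.
Proof.
case: k => // m muT _ f Lf; have [mf _] := Lf.
pose S := [set Lpow mu p setT f h | h in Gpk mu p m.+1].
have [z Gz _] := nearest_Gpk f [:: 0] m.+1 Lf (mem_head _ _) isT.
have S0 : S != set0 by apply/set0P; exists (Lpow mu p setT f z), z.
have [u Su ulim] := ereal_inf_seq S0.
have /choice[h hP] : forall n, exists h, Gpk mu p m.+1 h /\ Lpow mu p setT f h = u n.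
  by move=> n; have [h Gh <-] := Su n; exists h.
have /choice[s sP] : forall n, exists s : seq R,
    (size s <= m)%N /\ forall x, h n x \in 0 :: s.
  move=> n; have [Gh _] := hP n.
  by have [s sm hs] := Gpk_values _ _ muT Gh; exists s.
(* Past the end of [s n] the index reads the default 0, itself an allowed value. *)
have [phi iphi [b cb]] := multi_subseq_cvg_or_dvg m (fun n i => (s n)`_i).
(* Placeholders [b i] of divergent sequences stay in the list: an extra value only brings [g] closer
   to [f], and the size remains [m.+1]. *)
have [g Gg near_g] := nearest_Gpk f (0 :: mkseq b m) m.+1 Lf (mem_head _ _)
  ltac:(by rewrite /= size_mkseq).
have near_g0 x : `|f x - g x| <= `|f x|.
  by have := near_g x 0 (mem_head _ _); rewrite subr0.
exists g; apply/(minimizerP mu p p1).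
split; [exact: Gg|move=> h' Gh'].
apply: (@le_trans _ _ (ereal_inf S)); last by apply: ereal_inf_lbound; exists h'.
apply: (Lpow_liminf f g (h \o phi)) => //.
- by case: Gg => [? [? [? []]]].
- by move=> n; have [/Gpk_measurable] := hP (phi n).
- have -> : (fun n => Lpow mu p setT f ((h \o phi) n)) = u \o phi.
    by apply/funext => n /=; have [_] := hP (phi n).
  exact: (cvg_comp _ _ (increasing_seq_cvg _ iphi) ulim).
move=> x e e0.
have : \forall n \near \oo, forall i : 'I_m,
    `|f x - g x| - e <= `|f x - (s (phi n))`_i|.
  apply: filter_forall => i; have [cvg_bi|dvg] := cb i (ltn_ord i).
  - move/cvgrPdist_le : cvg_bi => /(_ _ e0); apply: filterS => n bn.
    have := near_g x (b i); rewrite inE map_f ?orbT ?mem_iota//= => /(_ isT) fb.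
    have := ler_distD (s (phi n))`_i (f x) (b i).
    by move: bn; rewrite [in X in X -> _]distrC; lra.
  (* A value of modulus at least [2 |f x|] is at distance at least [|f x|] from [f x], no better
     than 0. *)
  - move/cvgryPge : dvg => /(_ (`|f x| + `|f x|)); apply: filterS => n sn.
    have := lerB_dist (s (phi n))`_i (f x); rewrite distrC.
    by have := near_g0 x; lra.
apply: filterS => n fs /=; have [_] := sP (phi n) => /(_ x); rewrite inE.
move=> /orP[/eqP ->|/(nthP 0)[i si <-]].
  by rewrite subr0 (le_trans _ (near_g0 x))// gerBl ltW.
have [sm _] := sP (phi n).
exact: (fs (Ordinal (leq_trans si sm))).
Qed.

End Proximinal.

(** * The chosen mean [Mp] is a [p]-th mean *)

Section Means.
Context {d : measure_display} {T : measurableType d} {R : realType}.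
Context (mu : {measure set T -> \bar R}) (p : R) (p1 : 1 <= p).

(** The integral of [|f - y|] is a convex function of [y], possibly infinite, so its minimizers form
    an interval. *)
Lemma pth_mean1_convex (f : T -> R) A a b m : measurable_fun setT f ->
  measurable A -> pth_mean mu 1 f A a -> pth_mean mu 1 f A b ->
  a <= m <= b -> pth_mean mu 1 f A m.
Proof.
move=> mf mA Ea Eb /andP[am mb] c.
have [ab|ab] := eqVneq a b.
  by have -> : m = a by apply/le_anti; rewrite am ab mb.
pose t := (b - m) / (b - a).
have ab0 : 0 < b - a by rewrite subr_gt0 lt_neqAle ab (le_trans am).
have t0 : 0 <= t by rewrite divr_ge0 ?subr_ge0// ltW// -subr_gt0.
have t1 : 0 <= 1 - t.
  by rewrite subr_ge0 ler_pdivrMr// mul1r lerB.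
have mE : m = t * a + (1 - t) * b.
  have tE : t * (b - a) = b - m by rewrite mulfVK// gt_eqF.
  by lra.
clearbody t.
have mabs (y : R) : measurable_fun A (fun x => (`|f x - y| `^ 1)%:E).
  exact: (measurable_Lpow 1 A f (cst y)).
have nn (y x : R) : (0 <= (`|y - x| `^ 1)%:E)%E by rewrite lee_fin powR_ge0.
pose I (y : R) : \bar R := (\int[mu]_(x in A) (`|f x - y| `^ 1)%:E)%E.
have I_ge0 y : (0 <= I y)%E by apply: integral_ge0 => x _; exact: nn.
have mI (r y : R) : measurable_fun A (fun x => (r%:E * (`|f x - y| `^ 1)%:E)%E).
  by apply: measurable_funeM; exact: mabs.
have nnI (r y x : R) : 0 <= r -> (0 <= r%:E * (`|y - x| `^ 1)%:E)%E.
  by move=> r0; apply: mule_ge0; [rewrite lee_fin|exact: nn].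
have scale (r y : R) : 0 <= r ->
    (r%:E * I y = \int[mu]_(x in A) (r%:E * (`|f x - y| `^ 1)%:E))%E.
  by move=> r0; rewrite ge0_integralZl_EFin//.
have : (I m <= t%:E * I a + (1 - t)%:E * I b)%E.
  rewrite (scale _ _ t0) (scale _ _ t1) -(ge0_integralD _ mA); first last.
  - exact: mI.
  - by move=> x _; exact: nnI.
  - exact: mI.
  - by move=> x _; exact: nnI.
  apply: ge0_le_integral; [exact: mA|by move=> x _; exact: nn|exact: mabs| |].
  - by apply: emeasurable_funD; exact: mI.
  move=> x _; rewrite -!EFinM -EFinD lee_fin !powRr1//.
  have -> : f x - m = t * (f x - a) + (1 - t) * (f x - b) by rewrite mE; ring.
  by rewrite (le_trans (ler_normD _ _))// !normrM (ger0_norm t0) (ger0_norm t1).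
move=> /le_trans; apply.
apply: (@le_trans _ _ (t%:E * I c + (1 - t)%:E * I c)%E).
  apply: leeD; apply: lee_wpmul2l; rewrite ?lee_fin; [exact: t0|exact: Ea| |exact: Eb].
  exact: t1.
rewrite -ge0_muleDl ?lee_fin; [|exact: t0|exact: t1].
rewrite -EFinD addrC subrK mul1e; exact: lexx.
Qed.

(** Integrate [|a| <= |f| + |f - a|] over [A]: by minimality the right side is at most twice the
    integral of [|f|]. Boundedness makes [inf] and [sup] in [Mp] meaningful. *)
Lemma pth_mean1_bounded (f : T -> R) A : inLp mu 1 f -> measurable A ->
  (0 < mu A)%E -> (mu A < +oo)%E ->
  exists M, forall a, pth_mean mu 1 f A a -> `|a| <= M.
Proof.
move=> /(inLpP mu 1 (lexx 1))[mf Lf] mA A0 Aoo.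
pose I (y : R) : \bar R := (\int[mu]_(x in A) (`|f x - y| `^ 1)%:E)%E.
have mabs (y : R) : measurable_fun A (fun x => (`|f x - y| `^ 1)%:E).
  exact: (measurable_Lpow 1 A f (cst y)).
have nn (y x : R) : (0 <= (`|y - x| `^ 1)%:E)%E by rewrite lee_fin powR_ge0.
have I0 : (I 0%R < +oo)%E.
  apply: le_lt_trans Lf; rewrite /I; under eq_integral do rewrite subr0.
  apply: ge0_subset_integral => //.
  have := measurable_Lpow 1 setT f (cst 0) mf (measurable_cst _).
  by under eq_fun do rewrite /cst subr0.
have I0fin : I 0%R \is a fin_num.
  by rewrite ge0_fin_numE//; apply: integral_ge0 => x _; exact: nn.
have Afin : mu A \is a fin_num by rewrite ge0_fin_numE.
exists ((fine (I 0%R) + fine (I 0%R)) / fine (mu A)) => a Ea.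
rewrite ler_pdivlMr; last by rewrite fine_gt0// A0.
rewrite -lee_fin EFinM EFinD !fineK// -integral_cst//.
apply: (@le_trans _ _ (I 0%R + I a)%E); last by apply: leeD2l; exact: Ea.
rewrite /I -ge0_integralD//.
apply: ge0_le_integral => //.
- by move=> x _; rewrite lee_fin.
- by apply: emeasurable_funD; exact: mabs.
move=> x _; rewrite -EFinD lee_fin !powRr1//.
have := ler_normB (f x) (f x - a); rewrite subr0.
by have -> : f x - (f x - a) = a by lra.
Qed.

(** The given mean [a] makes the set of means nonempty. For [p > 1], [xget] then returns a member;
    for [p = 1], the midpoint is reached by convexity. *)
Lemma Mp_pth_mean (f : T -> R) A a : inLp mu p f -> measurable A ->
  (0 < mu A)%E -> (mu A < +oo)%E -> pth_mean mu p f A a ->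
  pth_mean mu p f A (Mp mu p f A).
Proof.
move=> Lf mA A0 Aoo Ea; rewrite /Mp (gt_eqF A0); case: ifPn => [_|].
  exact: (xgetI 0 (Ea : [set a | pth_mean mu p f A a] a)).
rewrite -leNgt => ple1; have pE : p = 1 by apply/le_anti; rewrite ple1.
rewrite pE in Lf Ea *; set E := [set _ | _].
have [M EM] := pth_mean1_bounded f A Lf mA A0 Aoo.
have E0 : E !=set0 by exists a.
have hs : has_sup E.
  by split=> //; exists M => y /EM; rewrite ler_norml => /andP[].
have hi : has_inf E.
  by split=> //; exists (- M) => y /EM; rewrite ler_norml => /andP[].
have [mf _] := Lf.
have infa : inf E <= a by apply: ge_inf => //; case: hi.
have asup : a <= sup E by apply: ub_le_sup => //; case: hs.
have [is_|is_] := eqVneq (inf E) (sup E).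
  suff -> : (inf E + sup E) / 2 = a by [].
  by move: infa asup; rewrite is_; lra.
(* Means within half the length of the two ends lie on either side of the midpoint. *)
have e0 : 0 < (sup E - inf E) / 2.
  by rewrite divr_gt0// subr_gt0 lt_neqAle is_ (le_trans infa).
have [y Ey yinf] := inf_adherent e0 hi.
have [z Ez zsup] := sup_adherent e0 hs.
apply: (pth_mean1_convex f A y z _ mf mA Ey Ez).
by apply/andP; split; lra.
Qed.

End Means.

(** * Modifying the values of a minimizer piece by piece *)

Section Minimizers.
Context {d : measure_display} {T : measurableType d} {R : realType}.
Context (mu : {measure set T -> \bar R}) (p : R) (p1 : 1 <= p).

Lemma Lpow_stepfun f q a (C : nat -> set T) : measurable_fun setT f ->
  mpartition q C -> Lpow mu p setT f (stepfun q a C) =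
  (\sum_(i < q) Lpow mu p (C i) f (cst (a i)))%E.
Proof.
move=> mf mC; rewrite /Lpow (integral_mpartition _ q C _ mC); first last.
- by move=> x; rewrite lee_fin powR_ge0.
- by apply: measurable_Lpow => //; exact: measurable_stepfun.
- apply: eq_bigr => i _; apply: eq_integral => x /[!inE] Cx.
  by rewrite (stepfunE _ _ _ _ _ mC (ltn_ord i) Cx).
Qed.

Lemma Lpow_null D f h : measurable D -> measurable_fun setT f ->
  measurable_fun setT h -> mu D = 0%E -> Lpow mu p D f h = 0%E.
Proof.
move=> mD mf mh D0; apply: null_set_integral => //.
exact: measurable_Lpow.
Qed.

Lemma minimizer_le k f g h : inLp mu p f -> minimizer mu p k f g ->
  Gpk mu p k h -> (Lpow mu p setT f h <= Lpow mu p setT f g)%E ->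
  minimizer mu p k f h.
Proof.
move=> Lf /(minimizerP mu p p1)[Gg gmin] Gh hg; apply/(minimizerP mu p p1).
split; [exact: Gh|move=> h' Gh'].
exact: le_trans hg (gmin _ Gh').
Qed.

(** [Gpk] grows with the number of values, so the smaller class has fewer competitors. *)
Lemma minimizer_leq q k f g : (q <= k)%N -> minimizer mu p k f g ->
  Gpk mu p q g -> minimizer mu p q f g.
Proof.
move=> qk /(minimizerP mu p p1)[_ gmin] Gg; apply/(minimizerP mu p p1).
split; [exact: Gg|move=> h Gh].
apply: gmin; move: Gh => [l [a [A [lq mA hE Lh]]]].
by exists l, a, A; split=> //; exact: leq_trans qk.
Qed.

(** Membership in [L^p] follows from the error bound, as the error of [g] is finite. *)
Lemma minimizer_stepfun q k f g a (C : nat -> set T) : inLp mu p f ->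
  (q <= k)%N -> mpartition q C -> minimizer mu p k f g ->
  (Lpow mu p setT f (stepfun q a C) <= Lpow mu p setT f g)%E ->
  minimizer mu p k f (stepfun q a C).
Proof.
move=> Lf qk mC gmin ag; apply: (minimizer_le k f g _ Lf gmin _ ag).
apply: Gpk_stepfun => //.
have Lg : inLp mu p g by case: gmin => -[? [? [? []]]].
apply: (inLp_Lpow mu p p1 f) => //; first exact: measurable_stepfun.
exact: le_lt_trans ag (Lpow_fin mu p p1 f g Lf Lg).
Qed.

(** A better constant [c] on [C i] would lower one term of the error and keep the others, against
    minimality. *)
Lemma minimizer_pth_mean q k f b (C : nat -> set T) i : inLp mu p f ->
  (q <= k)%N -> mpartition q C -> minimizer mu p k f (stepfun q b C) ->
  (i < q)%N -> pth_mean mu p f (C i) (b i).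
Proof.
move=> Lf qk mC bmin iq c; have [mf _] := Lf.
have Lb : inLp mu p (stepfun q b C) by case: bmin => -[? [? [? []]]].
pose a j := if j == i then c else b j.
rewrite leNgt; apply/negP => cb.
pose rest c' := (\sum_(j < q | j != Ordinal iq) Lpow mu p (C j) f (cst (c' j)))%E.
have splitE c' : Lpow mu p setT f (stepfun q c' C) =
    (Lpow mu p (C i) f (cst (c' i)) + rest c')%E.
  by rewrite (Lpow_stepfun _ _ _ _ mf mC) (bigD1 (Ordinal iq) isT).
have restE : rest a = rest b.
  apply: eq_bigr => j ji; rewrite /a ifF//; apply/negbTE.
  by move: ji; rewrite -val_eqE.
have ab : (Lpow mu p setT f (stepfun q a C) < Lpow mu p setT f (stepfun q b C))%E.
  have := Lpow_fin mu p p1 _ _ Lf Lb; rewrite (splitE a) (splitE b) restE.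
  (* The strict inequality survives adding [rest b] because that is finite, being part of a finite
     error. *)
  rewrite {1}/a eqxx => bfin; apply: lte_leD; [|exact: cb|exact: lexx].
  rewrite ge0_fin_numE; last by apply: sume_ge0 => *; exact: Lpow_ge0.
  by apply: le_lt_trans bfin; apply: leeDr; exact: Lpow_ge0.
have /(minimizerP mu p p1)[_ bmin'] := bmin.
have /(minimizerP mu p p1)[/bmin' + _] :=
  minimizer_stepfun q k f _ a C Lf qk mC bmin (ltW ab).
by rewrite leNgt ab.
Qed.

End Minimizers.

(** Links step functions with value 0 on piece [s] to the form of the improved minimizer in the
    theorem. *)
Lemma stepfun_drop0 (d : measure_display) (T : measurableType d)
    (R : realType) (q s : nat) (a : nat -> R) (C : nat -> set T) : (s < q)%N ->
  stepfun q (fun i => if i == s then 0 else a i) C =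
  (fun x => \sum_(i < q | i != s :> nat) a i * \1_(C i) x + 0 * \1_(C s) x).
Proof.
move=> sq; apply/funext => x; rewrite /stepfun (bigD1 (Ordinal sq))//= eqxx addrC.
congr (_ + _); apply: eq_big => [j|j]; first by rewrite -val_eqE.
by rewrite -val_eqE => /negbTE /= ->.
Qed.

Theorem theorem2p10 (d : measure_display) (T : measurableType d) (R : realType)
  (mu : {measure set T -> \bar R}) (p : R) (k : nat) :
  mu setT = +oo%E -> 1 <= p -> (1 <= k)%N ->
  proximinal mu p k /\
  (forall (f g : T -> R) (q : nat) (b : nat -> R) (A : nat -> set T),
     inLp mu p f -> minimizer mu p k f g ->
     (q <= k)%N ->
     (forall i j, (i < j)%N -> (j < q)%N -> b i < b j) ->
     mpartition q A ->
     (forall i, (i < q)%N -> (0 < mu (A i))%E) ->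
     g = stepfun q b A ->
     (exists2 s, (s < q)%N & b s = 0) /\
     (forall s, (s < q)%N -> b s = 0 ->
        let C := Cset q b f in
        (forall i, (i < q)%N -> i <> s -> (mu (C i) < +oo)%E) /\
        (forall i, (i < q)%N -> i <> s -> (0 < mu (C i))%E ->
           pth_mean mu p f (C i) (b i)) /\
        minimizer mu p q f
          (fun x => \sum_(i < q | i != s :> nat) Mp mu p f (C i) * \1_(C i) x
                    + 0 * \1_(C s) x) /\
        ((forall h m, minimizer mu p k f h -> at_most_values h m -> (q <= m)%N) ->
         forall i, (i < q)%N -> (0 < mu (C i))%E))).
Proof.
move=> muT p1 k0; split; first exact: proximinal_Gpk.
move=> f g q b A Lf gmin qk b_incr mA _ gE; have [mf _] := Lf.
have Lg : inLp mu p g by case: gmin => -[? [? [? []]]].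
split.
  have [i iq Aioo] := mpartition_infinite mu q A muT mA.
  exists i => //; apply: (stepfun_value0 mu p p1 q b A i mA) => //.
  by rewrite -gE.
move=> s sq bs0 C; have q0 : (0 < q)%N by exact: leq_ltn_trans sq.
have mC : mpartition q C by exact: Cset_mpartition.
have measC i : measurable (C i) by exact: measurable_Cset.
(* The values of [g] are kept and only the pieces are recut, so that each point gets its nearest
   value. *)
have Cmin : minimizer mu p k f (stepfun q b C).
  apply: (minimizer_stepfun mu p p1 q k f g b C Lf qk mC gmin).
  apply: le_Lpow => //; [exact: measurable_stepfun|by case: Lg|move=> x _].
  have [_ [_ covC]] := mC; have [i iq Ci] := covC x.
  have [_ [_ covA]] := mA; have [j jq Aj] := covA x.
  rewrite gE (stepfunE _ _ _ _ _ mC iq Ci) (stepfunE _ _ _ _ _ mA jq Aj).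
  exact: (Cset_nearest q b b_incr f).
have Cfin i : (i < q)%N -> i <> s -> (mu (C i) < +oo)%E.
  move=> iq si; have bi0 : b i != 0.
    rewrite -bs0; have [|] := ltnP i s.
      by move=> is_; rewrite lt_eqF// b_incr.
    by rewrite leq_eqVlt => /orP[/eqP/esym//|si']; rewrite gt_eqF// b_incr.
  (* On [C i] the value [b i] is at least as near to [f x] as [b s = 0], so
     [|b i| <= |f x| + |f x - b i| <= 2 |f x|]. *)
  apply: (Lp_superlevel_fin mu p p1 f (C i) (`|b i| / 2) Lf) => //.
    by rewrite divr_gt0// normr_gt0.
  move=> x Cx; have := Cset_nearest q b b_incr f i s x iq sq Cx.
  have := ler_normB (f x) (f x - b i).
  have -> : f x - (f x - b i) = b i by ring.
  by rewrite bs0 subr0; lra.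
have Cmean i : (i < q)%N -> pth_mean mu p f (C i) (b i).
  by move=> iq; exact: (minimizer_pth_mean mu p p1 q k).
have replace a :
    (forall i, (i < q)%N ->
      (Lpow mu p (C i) f (cst (a i)) <= Lpow mu p (C i) f (cst (b i)))%E) ->
    minimizer mu p k f (stepfun q a C).
  move=> ab; apply: (minimizer_stepfun mu p p1 q k f _ a C Lf qk mC Cmin).
  rewrite !(Lpow_stepfun mu p f q _ C mf mC).
  by apply: lee_sum => i _; exact: ab.
have null_le i y z : mu (C i) = 0%E ->
    (Lpow mu p (C i) f (cst y) <= Lpow mu p (C i) f (cst z))%E.
  by move=> Ci0; rewrite !Lpow_null//; exact: measurable_cst.
split; first exact: Cfin.
split; first by move=> i iq _ _; exact: Cmean.
split.
  rewrite -(stepfun_drop0 d T R q s (fun i => Mp mu p f (C i)) C sq).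
  set a := fun i => _.
  have amin : minimizer mu p k f (stepfun q a C).
    (* Piece [s] keeps its value 0, a null piece accepts any value, and elsewhere the mean is
       optimal. *)
    apply: replace => i iq; rewrite /a; have [->|/eqP si] := eqVneq i s.
      by rewrite bs0 lexx.
    have [Ci0|Ci0] := eqVneq (mu (C i)) 0%E; first exact: null_le.
    apply: (Mp_pth_mean mu p p1 f (C i) (b i) Lf (measC i) _ (Cfin i iq si)
      (Cmean i iq)).
    by rewrite lt_def Ci0 measure_ge0.
  apply: (minimizer_leq mu p p1 q k) => //; apply: Gpk_stepfun => //.
  by case: amin => -[? [? [? []]]].
move=> qleast i iq; rewrite lt_def measure_ge0 andbT; apply/eqP => Ci0.
have [j jq Cjoo] := mpartition_infinite mu q C muT mC.
(* Some cell has infinite measure and only [C s] can, so the null cell [C i] is another one. *)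
have si : i <> s.
  move=> is_; have : (mu (C j) < +oo)%E.
    by apply: Cfin => // js; move: Cjoo; rewrite js -is_ Ci0.
  by rewrite Cjoo ltxx.
(* Overwriting [b i] by 0, already taken as [b s], costs nothing on a null cell and leaves at most
   [q.-1] values. *)
pose a l := if l == i then 0 else b l.
have amin : minimizer mu p k f (stepfun q a C).
  apply: replace => l lq; rewrite /a; have [->|_] := eqVneq l i.
    exact: null_le.
  exact: lexx.
suff /(qleast _ _ amin) : at_most_values (stepfun q a C) q.-1.
  by rewrite -ltnS prednK// ltnn.
exists [seq b l | l <- rem i (iota 0 q)]; split.
  by rewrite size_map size_rem ?mem_iota// size_iota.
have mem_b l : (l < q)%N -> l != i -> b l \in [seq b l | l <- rem i (iota 0 q)].
  by move=> lq li; rewrite map_f// mem_rem_uniq ?iota_uniq// !inE li mem_iota.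
move=> x; have [_ [_ covC]] := mC; have [l lq Cl] := covC x.
rewrite (stepfunE _ _ _ _ _ mC lq Cl) /a.
have [_|li] := eqVneq l i; last exact: mem_b.
by rewrite -bs0; apply: mem_b => //; apply/eqP => /esym.
Qed.
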